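(* Let $p\ge 5$ be a prime and let $F_p$ be the Frobenius group of order $p(p-1)$, that is, $F_p=\langle a,b : a^p=b^{p-1}=1,\ b^{-1}ab=a^n\rangle\cong\mathbb Z_p\rtimes\mathbb Z_{p-1}$, where $n$ is an integer that is a primitive root modulo $p$. Then the nim-value of the avoidance game on $F_p$ is $0$, i.e. $DNG(F_p)=*0$.
   Context: The avoidance game $DNG(G)$ on a finite non-trivial group $G$: two players alternately choose a not-yet-chosen element of $G$ in such a way that the set of jointly chosen elements does not generate $G$. A player who cannot make such a choice loses (the player making the last move wins). A position is the set of jointly chosen elements (a non-generating subset of $G$); the starting position is $\emptyset$. The options $Opt(P)$ of a position $P$ are the sets $P\cup\{g\}$ with $g\in G\setminus P$ and $\langle P\cup\{g\}\rangle\neq G$. The nim-value is defined recursively by $nim(P)=mex\{nim(Q): Q\in Opt(P)\}$, where $mex(A)$ is the smallest non-negative integer not in $A$. The nim-value of the game is $nim(\emptyset)$, and $DNG(G)=*k$ means that it equals $k$. *)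

(* Defs.v *)
From HB Require Import structures.
From mathcomp Require Import all_boot all_order all_algebra all_fingroup.

Set Implicit Arguments.
Unset Strict Implicit.
Unset Printing Implicit Defensive.

Local Open Scope group_scope.

Lemma mex_exists (s : seq nat) : exists n, n \notin s.
Proof.
exists (\max_(m <- s) m).+1; apply/negP => ms.
by have := @leq_bigmax_seq _ s xpredT (fun m => m) _ ms isT; rewrite ltnn.
Qed.

Definition mex (s : seq nat) : nat := ex_minn (mex_exists s).

Section AvoidanceGame.

Variables (gT : finGroupType) (G : {group gT}).
Implicit Type P : {set gT}.

Definition options P : {set {set gT}} :=
  [set g |: P | g in G :\: P & <<g |: P>> != G].

(* The nim-value by recursion on fuel: every option of P leaves strictly fewer
   elements of G unchosen, so #|G :\: P| steps suffice. The recursive equation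
   defining the nim-value is nimE below. *)
Fixpoint nim_rec (k : nat) P : nat :=
  if k is k'.+1 then mex [seq nim_rec k' Q | Q <- enum (options P)] else 0.

Definition nim P : nat := nim_rec #|G :\: P|.+1 P.

Lemma options_card P Q : Q \in options P -> #|G :\: Q| < #|G :\: P|.
Proof.
case/imsetP => g; rewrite 2!inE => /andP[/andP[Pg Gg] _] ->.
by rewrite setUC -setDDl [ltnRHS](cardsD1 g) !inE Gg Pg.
Qed.

Lemma nim_rec_fuel k P : #|G :\: P| < k -> nim_rec k P = nim P.
Proof.
rewrite /nim; move: {-1 3}#|G :\: P|.+1 (leqnn #|G :\: P|.+1) => l.
elim: k P l => // k IHk P [|l] //= ltl ltk; congr mex; apply/eq_in_map => Q.
rewrite mem_enum => /options_card ltQ; rewrite !ltnS in ltl ltk.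
by apply: IHk; [apply: leq_trans ltl | apply: leq_trans ltk].
Qed.

Lemma nimE P : nim P = mex [seq nim Q | Q <- enum (options P)].
Proof.
rewrite {1}/nim /=; congr mex; apply/eq_in_map => Q.
by rewrite mem_enum => /options_card; apply: nim_rec_fuel.
Qed.

Definition DNG : nat := nim set0.

End AvoidanceGame.

(* n is an integer, possibly negative: Negz m stands for - m.+1, and a ^- m.+1
   for (a ^+ m.+1)^-1. *)
Definition Frobenius_presentation (p : nat) (n : int) (gT : finGroupType)
    (G : {group gT}) : Prop :=
  match n with
  | Posz m =>
      G \isog Grp (a : b : a ^+ p = b ^+ p.-1 = 1, a ^ b = a ^+ m)
  | Negz m =>
      G \isog Grp (a : b : a ^+ p = b ^+ p.-1 = 1, a ^ b = a ^- m.+1)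
  end.

Definition primitive_root_mod (p : nat) (n : int) : bool :=
  (p.-1.-primitive_root (n%:~R : 'F_p))%R.

(* Main.v *)
(* Once the chosen elements generate a proper subgroup of even order, every
   maximal position that play can reach is a maximal subgroup of even order, so
   the parity of the number of chosen elements decides the winner. Hence the
   second player wins as soon as every g of odd order lies with some involution
   t in a proper subgroup. In the Frobenius group with kernel N = <[a]>, any
   involution t works if g is in N, since N <[t]> has order 2p < p(p-1);
   otherwise the centraliser of g has the even order p-1, and any involution t
   in it generates with g an abelian, hence proper, subgroup. *)

Require Import Defs.
From mathcomp Require Import all_boot all_order all_algebra all_fingroup.
From mathcomp Require Import all_solvable.

Set Implicit Arguments.
Unset Strict Implicit.
Unset Printing Implicit Defensive.

Import GRing.Theory.
Local Open Scope group_scope.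

Lemma mex_eq0 (s : seq nat) : (mex s == 0) = (0 \notin s).
Proof.
rewrite /mex; case: ex_minnP => m ms m_min.
by apply/eqP/idP => [<- // | /m_min]; rewrite leqn0 => /eqP.
Qed.

(** * Parity of positions in the avoidance game on an arbitrary finite group *)

Section Avoidance.

Variables (gT : finGroupType) (G : {group gT}).
Implicit Types (g t : gT) (P Q : {set gT}).

Lemma nim_eq0P P :
  reflect (forall Q, Q \in options G P -> nim G Q != 0) (nim G P == 0).
Proof.
rewrite nimE mex_eq0; apply: (iffP idP) => [P0 Q PQ | nzQ].
  apply: contra P0 => /eqP Q0; apply/mapP; exists Q => //.
  by rewrite mem_enum.
by apply/mapP => -[Q]; rewrite mem_enum => /nzQ + Q0; rewrite -Q0.
Qed.

Lemma mem_options g P :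
  g \in G -> g \notin P -> <<g |: P>> != G -> g |: P \in options G P.
Proof.
by move=> Gg Pg ltPG; apply/imsetP; exists g; rewrite // !inE Gg Pg ltPG.
Qed.

(** Induction on the number of unchosen elements. From an even position every option is odd and, by
    Lagrange, still generates a subgroup of even order. An odd position cannot fill the even-order
    group [<<P>>], so some [g] of it is unchosen; adding [g] leaves [<<P>>] unchanged and gives an
    even position. *)
Lemma nim_even_order P :
    P \subset G -> <<P>> != G -> ~~ odd #|<<P>>| ->
  (nim G P == 0) = ~~ odd #|P|.
Proof.
have [k] := ubnP #|G :\: P|; elim: k P => // k IHk P leGPk sPG neqPG evP.
have [oP | eP] := boolP (odd #|P|); last first.
  apply/nim_eq0P => Q PQ; have /imsetP[g] := PQ.
  rewrite 2!inE => /andP[/andP[Pg Gg] neqQG] defQ.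
  have sQG : Q \subset G by rewrite defQ subUset sub1set Gg.
  have evQ : ~~ odd #|<<Q>>|.
    move: evP; rewrite -!dvdn2 => /dvdn_trans; apply.
    by rewrite defQ cardSg ?genS ?subsetUr.
  rewrite IHk ?(leq_trans (options_card PQ)) //; last by rewrite defQ.
  by rewrite defQ cardsU1 Pg oddD (negbTE eP).
apply/negbTE/nim_eq0P => nzQ.
have /subsetPn[g Pg P'g] : ~~ (<<P>> \subset P).
  apply: contra evP => sPP; suff -> : <<P>> = P :> {set gT} by [].
  by apply/eqP; rewrite eqEsubset sPP subset_gen.
have Gg : g \in G by apply: subsetP Pg; rewrite gen_subG.
have defQ : <<g |: P>> = <<P>>.
  apply/eqP; rewrite eqEsubset [in X in _ && X]genS ?subsetUr // andbT.
  by rewrite gen_subG subUset sub1set Pg subset_gen.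
have PQ : g |: P \in options G P by rewrite mem_options ?defQ.
have /negP[] := nzQ _ PQ; rewrite IHk ?defQ //.
- by rewrite cardsU1 P'g oddD oP.
- exact: leq_trans (options_card PQ) _.
- by rewrite subUset sub1set Gg.
Qed.

Lemma DNG_eq0 :
    {in G, forall g, odd #[g] ->
       exists t, [/\ t \in G, #[t] = 2 & <<t |: [set g]>> != G]} ->
  DNG G = 0.
Proof.
move=> invG; apply/eqP/nim_eq0P => _ /imsetP[g + ->].
rewrite inE setU0 => /andP[/setDP[Gg _] neqgG].
have [og | eg] := boolP (odd #[g]); last first.
  by rewrite nim_even_order ?sub1set ?cards1.
(* The reply [t] gives a two-element position whose generated subgroup has even order, hence
   nim-value 0. *)
have [t [Gt ot neqtG]] := invG g Gg og.
have gt : t \notin [set g] by apply: contraTN og => /set1P <-; rewrite ot.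
apply/nim_eq0P => /(_ _ (mem_options Gt gt neqtG)); rewrite nim_even_order //.
- by rewrite cardsU1 gt cards1.
- by rewrite subUset !sub1set Gt.
- rewrite -dvdn2 -ot; apply: order_dvdG.
  by rewrite mem_gen // !inE eqxx.
Qed.

End Avoidance.

(* The order of the presented group is at least p(p-1), because it maps onto the
   group of affine permutations x |-> k^j x + i of 'F_p. *)
Section AffineModel.

Variables (p k : nat).
Hypotheses (p_pr : prime p) (k_prim : (p.-1.-primitive_root (k%:R : 'F_p))%R).

Let z : 'F_p := (k%:R)%R.

Let z_neq0 : (z != 0)%R.
Proof.
apply/eqP => z0; have := prim_expr_order k_prim; rewrite -/z z0 expr0n.
rewrite eqn0Ngt (prim_order_gt0 k_prim) => /esym/eqP.
by rewrite oner_eq0.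
Qed.

Definition translation : {perm 'F_p} := perm (@addrI 'F_p 1%R).
Definition scaling : {perm 'F_p} := perm (mulfI z_neq0).

Lemma translationX i x : (translation ^+ i) x = (i%:R + x)%R.
Proof.
elim: i => [|i IHi]; first by rewrite perm1 add0r.
by rewrite expgSr permM IHi permE mulrS addrA.
Qed.

Lemma scalingX i x : (scaling ^+ i) x = (z ^+ i * x)%R.
Proof.
elim: i => [|i IHi]; first by rewrite perm1 mul1r.
by rewrite expgSr permM IHi permE exprS mulrA.
Qed.

Lemma order_translation : #[translation] = p.
Proof.
apply/eqP; rewrite eqn_dvd; apply/andP; split.
  rewrite order_dvdn; apply/eqP/permP => x.
  by rewrite translationX pchar_Fp_0 // add0r perm1.
(* The trivial power of [translation] is evaluated at 0. *)
rewrite (dvdn_pcharf (pchar_Fp p_pr)); apply/eqP.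
by rewrite -[LHS]addr0 -translationX expg_order perm1.
Qed.

Lemma order_scaling : #[scaling] = p.-1.
Proof.
apply/eqP; rewrite eqn_dvd; apply/andP; split.
  rewrite order_dvdn; apply/eqP/permP => x.
  by rewrite scalingX (prim_expr_order k_prim) mul1r perm1.
rewrite (prim_order_dvd k_prim); apply/eqP.
by rewrite -[LHS]mulr1 -scalingX expg_order perm1.
Qed.

Lemma translationJ : translation ^ scaling = translation ^+ k.
Proof.
(* Permutations compose from left to right, so the claim becomes k(1 + x) = k + kx. *)
apply/eqP; rewrite -(inj_eq (mulgI scaling)) -conjgC; apply/eqP/permP => x.
by rewrite !permM translationX !permE mulrDr mulr1.
Qed.

Lemma affine_homGrp :
  <[translation]> <*> <[scaling]>
    \homg Grp (a : b : a ^+ p = b ^+ p.-1 = 1, a ^ b = a ^+ k).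
Proof.
apply/existsP; exists (translation, scaling); rewrite /= !xpair_eqE.
rewrite eqxx translationJ eqxx andbT /=.
by rewrite -!order_dvdn order_translation order_scaling !dvdnn.
Qed.

Lemma affine_card : p * p.-1 %| #|<[translation]> <*> <[scaling]>|.
Proof.
rewrite Gauss_dvd; last by rewrite coprimenP ?prime_gt0.
rewrite -[X in (X %| _) && _]order_translation.
rewrite -[X in _ && (X %| _)]order_scaling.
by rewrite !cardSg ?joing_subl ?joing_subr.
Qed.

End AffineModel.

Lemma Frobenius_presentation_nat (p : nat) (n : int) (gT : finGroupType)
    (G : {group gT}) :
  prime p -> Frobenius_presentation p n G ->
  exists2 k : nat, (k%:R = n%:~R :> 'F_p)%R
    & G \isog Grp (a : b : a ^+ p = b ^+ p.-1 = 1, a ^ b = a ^+ k).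
Proof.
move=> p_pr; case: n => m isoG; first by exists m.
(* As p - 1 is -1 modulo p, this natural number is congruent to -(m+1), and it gives the same power
   of any [x] with [x ^+ p = 1]. *)
exists (m.+1 * p.-1)%N.
  apply/eqP; rewrite NegzE mulrNz -subr_eq0 opprK -natrD.
  by rewrite -mulnSr prednK ?prime_gt0 // natrM pchar_Fp_0 ?mulr0.
have expE (rT : finGroupType) (x : rT) :
    x ^+ p = 1 -> x ^- m.+1 = x ^+ (m.+1 * p.-1)%N.
  move=> xp; apply: (mulgI (x ^+ m.+1)); rewrite mulgV -expgD -mulnS.
  by rewrite prednK ?prime_gt0 // mulnC expgM xp expg1n.
move=> rT H; rewrite isoG.
apply/existsP/existsP => -[[x y]] /= /eqP[<- xp yp xy];
  by exists (x, y); rewrite /= !xpair_eqE xp yp xy expE ?eqxx.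
Qed.

(** * Centralisers and involutions in the Frobenius group *)

Section FrobeniusGroup.

Variables (p k : nat) (gT : finGroupType) (G : {group gT}) (a b : gT).
Hypotheses (p_pr : prime p) (k_prim : (p.-1.-primitive_root (k%:R : 'F_p))%R).
Hypotheses (oa : #[a] = p) (ob : #[b] = p.-1) (ab : a ^ b = a ^+ k).
Hypotheses (defG : <[a]> * <[b]> = G) (oG : #|G| = (p * p.-1)%N).

Let sNG : <[a]> \subset G.
Proof. by rewrite -defG mulG_subl. Qed.

Let nNb : <[b]> \subset 'N(<[a]>).
Proof. by rewrite norms_cycle ab mem_cycle. Qed.

Let nNG : G \subset 'N(<[a]>).
Proof. by rewrite -defG mul_subG ?normG. Qed.

Let conjaX j : a ^ (b ^+ j) = a ^+ (k ^ j).
Proof.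
elim: j => [|j IHj]; first by rewrite conjg1.
by rewrite expgSr conjgM IHj conjXg ab -expgM expnS.
Qed.

(** If [a ^+ i * b ^+ j] centralises [a], then k^j = 1 modulo p; since k is a primitive root, p - 1
    divides j and [b ^+ j = 1]. *)
Lemma Frobenius_cent_kernel : 'C_G[a] \subset <[a]>.
Proof.
apply/subsetP => x /setIP[]; rewrite -defG.
case/mulsgP=> _ _ /cycleP[i ->] /cycleP[j ->] ->.
rewrite groupMl ?mem_cycle //; last by rewrite groupX ?cent1id.
rewrite cent1C => /cent1P/commgP/conjg_fixP; rewrite conjaX => /eqP.
rewrite -{2}[a]expg1 eq_expg_mod_order oa => /eqP kj1.
have: (k%:R ^+ j == 1 :> 'F_p)%R.
  by rewrite -natrX -(Fp_nat_mod p_pr) kj1 Fp_nat_mod.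
rewrite -(prim_order_dvd k_prim) -ob order_dvdn => /eqP ->.
by rewrite mulg1 mem_cycle.
Qed.

(** The quotient by [<[a]>] is an image of [<[b]>], hence abelian, so [<[a]>] contains every
    commutator. *)
Lemma Frobenius_class_sub g : g \in G -> g ^: G \subset g *: <[a]>.
Proof.
move=> Gg; apply/subsetP => _ /imsetP[y Gy ->].
rewrite mem_lcoset -commgEl.
have sG'N : [~: G, G] \subset <[a]>.
  rewrite -derg1 der1_min // -defG quotientMidl.
  by rewrite quotient_abelian ?cycle_abelian.
by apply: (subsetP sG'N); rewrite mem_commg.
Qed.

(** The centraliser meets the kernel trivially, which bounds its order above by p - 1; the class of
    [g] lies in a coset of size p, which bounds it below. *)
Lemma Frobenius_card_cent1 g : g \in G -> g \notin <[a]> -> #|'C_G[g]| = p.-1.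
Proof.
move=> Gg N'g; have p_gt0 := prime_gt0 p_pr.
have tiNC : <[a]> :&: 'C_G[g] = 1.
  apply: prime_TIg; first by rewrite -orderE oa.
  apply: contra N'g; rewrite cycle_subG => /setIP[_ cga].
  by apply: (subsetP Frobenius_cent_kernel); rewrite in_setI Gg cent1C.
have le_index : #|G : 'C_G[g]| <= p.
  rewrite index_cent1 (leq_trans (subset_leq_card (Frobenius_class_sub Gg))) //.
  by rewrite card_lcoset -orderE oa.
apply/eqP; rewrite eqn_leq; apply/andP; split.
  rewrite -(leq_pmul2l p_gt0) -oG -{1}oa orderE -TI_cardMg //.
  by rewrite subset_leq_card // mul_subG ?subsetIl.
rewrite -(leq_pmul2l p_gt0) -oG -(Lagrange (subsetIl G 'C[g])) mulnC.
by rewrite leq_mul2r le_index orbT.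
Qed.

Lemma Frobenius_involution g :
    5 <= p -> g \in G ->
  exists t, [/\ t \in G, #[t] = 2 & <<t |: [set g]>> != G].
Proof.
move=> p_ge5 Gg.
have p1_even : 2 %| p.-1.
  by rewrite dvdn2; case: p p_pr p_ge5 => // m /even_prime[-> //|/=].
have [Ng | N'g] := boolP (g \in <[a]>).
  have [|t Gt ot] := @Cauchy _ 2 G isT; first by rewrite oG dvdn_mull.
  exists t; split=> //; apply: contraTneq p_ge5 => genG.
  have sGNt : G \subset <[a]> * <[t]>.
    rewrite -norm_joinEr; last by rewrite (subset_trans _ nNG) ?cycle_subG.
    rewrite -genG gen_subG subUset !sub1set.
    by rewrite !mem_gen // !inE ?cycle_id ?Ng ?orbT.
  have : #|G| <= p * 2.
    rewrite -{1}oa -ot !orderE mul_cardG.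
    by rewrite (leq_trans (subset_leq_card sGNt)) ?leq_pmulr ?cardG_gt0.
  by rewrite oG leq_pmul2l ?prime_gt0 // -ltnNge; case: (p) => [|[|[|[|[]]]]].
have [|t /setIP[Gt cgt] ot] := @Cauchy _ 2 'C_G[g] isT.
  by rewrite Frobenius_card_cent1.
(* If the commuting elements [t] and [g] generated [G], then [g] would centralise [a] and so lie in
   the kernel. *)
exists t; split=> //; apply: contraNneq N'g => genG.
have abG : abelian G.
  rewrite -genG abelian_gen; apply/centsP => x.
  by case/setU1P=> [->|/set1P->] y /setU1P[->|/set1P->] //; apply/cent1P;
    rewrite // cent1C.
apply: (subsetP Frobenius_cent_kernel); rewrite in_setI Gg /=.
by apply/cent1P; apply: (centsP abG) => //; rewrite -cycle_subG.
Qed.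

End FrobeniusGroup.

Theorem proposition3p3 (p : nat) (n : int) (gT : finGroupType)
    (G : {group gT}) (p_prime : prime p) (p_ge5 : 5 <= p)
    (n_primitive : primitive_root_mod p n)
    (G_Frobenius : Frobenius_presentation p n G) :
  DNG G = 0.
Proof.
have [k kE isoG] := Frobenius_presentation_nat p_prime G_Frobenius.
move: n_primitive; rewrite /primitive_root_mod -kE => k_prim.
have p_gt0 := prime_gt0 p_prime.
have p1_gt0 : 0 < p.-1 by rewrite -subn1 subn_gt0 prime_gt1.
have dvd_oG : p * p.-1 %| #|G|.
  apply: dvdn_trans (affine_card p_prime k_prim) _.
  by apply: card_homg; rewrite isoG affine_homGrp.
have /existsP[[a b] /= /eqP[defG ap bp ab]] := isoGrp_hom isoG.
rewrite norm_joinEr in defG; last by rewrite norms_cycle ab mem_cycle.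
have dvd_oa : #[a] %| p by rewrite order_dvdn ap.
have dvd_ob : #[b] %| p.-1 by rewrite order_dvdn bp.
have le_oa := dvdn_leq p_gt0 dvd_oa; have le_ob := dvdn_leq p1_gt0 dvd_ob.
(* The relations bound the orders of [a] and [b] only from above; this lower bound on their product
   forces equality in both. *)
have le_oG : p * p.-1 <= #|<[a]>| * #|<[b]>|.
  rewrite mul_cardG defG (leq_trans (dvdn_leq (cardG_gt0 G) dvd_oG)) //.
  by rewrite leq_pmulr.
rewrite -!orderE in le_oG.
have oa : #[a] = p.
  apply/eqP; rewrite eqn_leq le_oa -(leq_pmul2r p1_gt0) (leq_trans le_oG) //.
  by rewrite leq_mul2l le_ob orbT.
have ob : #[b] = p.-1.
  apply/eqP; rewrite eqn_leq le_ob -(leq_pmul2l p_gt0) (leq_trans le_oG) //.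
  by rewrite leq_mul2r le_oa orbT.
have oG : #|G| = (p * p.-1)%N.
  apply/eqP; rewrite eqn_leq (dvdn_leq _ dvd_oG) ?cardG_gt0 // andbT.
  rewrite -defG (leq_trans _ (leq_mul le_oa le_ob)) // !orderE.
  by rewrite mul_cardG leq_pmulr.
apply: DNG_eq0 => g Gg _.
exact: (Frobenius_involution p_prime k_prim oa ob ab defG oG p_ge5 Gg).
Qed.
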